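(* Let $k\geq 1$ be an integer with $k\neq 2$. Then all positive integer solutions $(x,y)$ of the equation $x^{2}-(k^{2}+1)y^{2}=4$ are given by $$(x,y)=\left(V_{2n}(2k,1),2U_{2n}(2k,1)\right)$$ with $n\geq 1$. That is, the set of pairs of positive integers solving the equation is exactly the set of these pairs as $n$ ranges over the integers $n\ge 1$.
   Context: For nonzero integers $m,s$ with $m^{2}+4s>0$, the generalized Fibonacci sequence is defined by $U_{0}(m,s)=0$, $U_{1}(m,s)=1$, $U_{n+1}(m,s)=mU_{n}(m,s)+sU_{n-1}(m,s)$ for $n\ge 1$, and the generalized Lucas sequence by $V_{0}(m,s)=2$, $V_{1}(m,s)=m$, $V_{n+1}(m,s)=mV_{n}(m,s)+sV_{n-1}(m,s)$ for $n\ge 1$. *)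

(* Defs.v *)
From mathcomp Require Import all_boot all_order all_algebra.

Set Implicit Arguments.
Unset Strict Implicit.
Unset Printing Implicit Defensive.

Import Order.TTheory GRing.Theory Num.Theory.

Local Open Scope ring_scope.

(* Generalized Fibonacci and Lucas sequences U_n(m, s) and V_n(m, s). The
   recurrences make sense for all integers m, s; the usual standing assumptions
   m, s <> 0 and m^2 + 4 s > 0 are not needed to define them, and they hold for
   (m, s) = (2k, 1) with k >= 1. *)

Fixpoint genFib (m s : int) (n : nat) : int :=
  match n with
  | 0%N => 0
  | n1.+1 =>
      match n1 with
      | 0%N => 1
      | n2.+1 => m * genFib m s n1 + s * genFib m s n2
      end
  end.

Fixpoint genLucas (m s : int) (n : nat) : int :=
  match n with
  | 0%N => 2
  | n1.+1 =>
      match n1 with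
      | 0%N => m
      | n2.+1 => m * genLucas m s n1 + s * genLucas m s n2
      end
  end.

(* Main.v *)
Require Import Defs.
From mathcomp Require Import all_boot all_order all_algebra.
From mathcomp Require Import zify ring.

Set Implicit Arguments.
Unset Strict Implicit.
Unset Printing Implicit Defensive.

Import Order.TTheory GRing.Theory Num.Theory.

Local Open Scope ring_scope.

(** Put [d = k ^+ 2 + 1].  The element [k + sqrt d] has norm [-1], and
    multiplying [V n + 2 U n * sqrt d] by it gives the next pair
    ([genLucas_genFib_succ]); since the pair of index [0] is [2], whose
    norm is [4], the pair of index [n] has norm [4 (-1) ^+ n] and the pairs of
    even index solve the equation.

    Conversely, treat the norms [4] and [-4] together and divide a solution
    [x + y * sqrt d] by [k + sqrt d].  The quotient [x' + y' * sqrt d], where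
    [x' = d y - k x] and [y' = x - k y], has the opposite norm, and
    [0 <= y' < y], [0 < x'] as soon as [2 <= y] ([descent_step]).  So the descent
    can stop only at [y = 0], which forces [x = 2] and is the pair of index [0],
    or at [y = 1], where [x ^+ 2] would be [k ^+ 2 + 5] or [k ^+ 2 - 3].  Such
    squares exist only for [k = 2] ([norm4_y_neq1]), which is where the
    hypothesis on [k] enters.  Hence every solution of norm [4] or [-4] is some
    pair of index [n] ([norm4_lucas_fib]), and norm [4] forces [n] to be even. *)

(** Multiplication by [k + sqrt d]: this element is a root of
    [z ^+ 2 = 2 k z + 1], so its multiples satisfy the recurrence of both
    sequences, and it sends [2] to the pair of index [1].  Over the integers the
    two coordinates have to be proved together. *)
Lemma genLucas_genFib_succ (k : int) (n : nat) :
  genLucas (2 * k) 1 n.+1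
    = k * genLucas (2 * k) 1 n + (k ^+ 2 + 1) * (2 * genFib (2 * k) 1 n) /\
  2 * genFib (2 * k) 1 n.+1
    = k * (2 * genFib (2 * k) 1 n) + genLucas (2 * k) 1 n.
Proof.
elim: n => [|n [IHV IHU]]; first by split=> /=; ring.
have VS : genLucas (2 * k) 1 n.+2
  = 2 * k * genLucas (2 * k) 1 n.+1 + 1 * genLucas (2 * k) 1 n by [].
have US : 2 * genFib (2 * k) 1 n.+2
  = 2 * k * (2 * genFib (2 * k) 1 n.+1) + 2 * genFib (2 * k) 1 n.
  by rewrite -[genFib _ _ n.+2]/(2 * k * genFib (2 * k) 1 n.+1
                                + 1 * genFib (2 * k) 1 n); ring.
rewrite VS US IHU IHV; split; ring.
Qed.

Lemma genLucas_genFib_norm (k : int) (n : nat) :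
  genLucas (2 * k) 1 n ^+ 2 - (k ^+ 2 + 1) * (2 * genFib (2 * k) 1 n) ^+ 2
    = 4 * (-1) ^+ n.
Proof.
elim: n => [|n IHn]; first by rewrite /= expr0; ring.
have [-> ->] := genLucas_genFib_succ k n.
by rewrite [in RHS]exprS mulN1r mulrN -IHn; ring.
Qed.

Lemma genLucas_genFib_gt0 (k : int) (n : nat) : 1 <= k ->
  0 < genLucas (2 * k) 1 n /\ 0 <= genFib (2 * k) 1 n.
Proof.
move=> k1; elim: n => [|n [V0 U0]] //.
have [-> Un] := genLucas_genFib_succ k n; split; first by nia.
suff: 0 <= 2 * genFib (2 * k) 1 n.+1 by lia.
by rewrite Un; nia.
Qed.

(** [(x - k) * (x + k)] would be [5] or [-3]; as these have only one positive
    factorization up to sign, [x] and [k] are consecutive and [k = 2]. *)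
Lemma norm4_y_neq1 (k x e : int) : 1 <= k -> k <> 2 -> 0 < x ->
  e = 4 \/ e = - 4 -> x ^+ 2 <> k ^+ 2 + 1 + e.
Proof.
move=> k1 k2 x0 [] -> E.
- have xk : k + 1 <= x by nia.
  have : x <= k + 2 by nia.
  by nia.
- have xk : x + 1 <= k by nia.
  have : k <= x + 1 by nia.
  by nia.
Qed.

(** Each product [y' * (x + k y)] and [x' * (d y + k x)] is a difference of two
    squares, [y ^+ 2 + e] and [d y ^+ 2 - k ^+ 2 e], which [2 <= y] keeps on the
    right side of [0]; the value [y = 2], [e = - 4] gives [y' = 0], so only the
    weak inequality holds for [y']. *)
Lemma descent_step (k x y e : int) : 1 <= k -> 0 < x -> 2 <= y ->
  e = 4 \/ e = - 4 -> x ^+ 2 - (k ^+ 2 + 1) * y ^+ 2 = e ->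
  [/\ 0 < (k ^+ 2 + 1) * y - k * x, 0 <= x - k * y, x - k * y < y &
      ((k ^+ 2 + 1) * y - k * x) ^+ 2 - (k ^+ 2 + 1) * (x - k * y) ^+ 2 = - e].
Proof.
move=> k1 x0 y2 he E.
have e4 : - 4 <= e <= 4 by lia.
have Et : (x - k * y) * (x + k * y) = y ^+ 2 + e by rewrite -E; ring.
have Ex : ((k ^+ 2 + 1) * y - k * x) * ((k ^+ 2 + 1) * y + k * x)
          = (k ^+ 2 + 1) * y ^+ 2 - k ^+ 2 * e by rewrite -E; ring.
have ky : 0 < k * y by nia.
have kx : 0 < k * x by nia.
have y4 : 4 <= y ^+ 2 by nia.
split; last by rewrite -E; ring.
- have : 0 < (k ^+ 2 + 1) * y ^+ 2 - k ^+ 2 * e by nia.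
  rewrite -Ex pmulr_lgt0 //; nia.
- have : 0 <= y ^+ 2 + e by lia.
  by rewrite -Et pmulr_lge0 //; lia.
- rewrite ltNge; apply/negP => ty.
  have : y * (y + 2 * (k * y)) <= (x - k * y) * (x + k * y) by nia.
  rewrite Et; nia.
Qed.

Lemma norm4_lucas_fib (k : int) : 1 <= k -> k <> 2 ->
  forall x y e : int, 0 < x -> 0 <= y -> e = 4 \/ e = - 4 ->
  x ^+ 2 - (k ^+ 2 + 1) * y ^+ 2 = e ->
  exists n : nat, x = genLucas (2 * k) 1 n /\ y = 2 * genFib (2 * k) 1 n.
Proof.
move=> k1 k2 x y e x0 y0; move: {2}`|y|%N (leqnn `|y|%N) => N.
elim: N x y e x0 y0 => [|N IHN] x y e x0 y0 yN he E.
  have yE : y = 0 by lia.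
  by exists 0%N; split=> /=; move: E; rewrite yE; nia.
have [y2|y1] := leP 2 y; last first.
  have [yE|yE] : y = 0 \/ y = 1 by lia.
    by exists 0%N; split=> /=; move: E; rewrite yE; nia.
  by case: (norm4_y_neq1 k1 k2 x0 he); rewrite -E yE; ring.
have [x'0 y'0 y'y E'] := descent_step k1 x0 y2 he E.
have [||n [Vn Un]] := IHN _ _ (- e) x'0 y'0 _ _ E'; try lia.
have [VS US] := genLucas_genFib_succ k n.
by exists n.+1; rewrite VS US -Vn -Un; split; ring.
Qed.

Theorem theorem21 (k : int) (hk : 1 <= k) (hk2 : k <> 2) (x y : int) :
  (0 < x /\ 0 < y /\ x ^+ 2 - (k ^+ 2 + 1) * y ^+ 2 = 4) <->
  (exists n : nat, (1 <= n)%N /\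
     (x, y) = (genLucas (2 * k) 1 (2 * n)%N, 2 * genFib (2 * k) 1 (2 * n)%N)).
Proof.
split=> [[x0 [y0 E]]|[n [n1 [-> ->]]]].
- have [n [Vn Un]] := norm4_lucas_fib hk hk2 x0 (ltW y0) (or_introl erefl) E.
  have n_even : ~~ odd n.
    apply/negP => n_odd; have := genLucas_genFib_norm k n.
    by rewrite -Vn -Un E -signr_odd n_odd.
  have nE : (2 * n./2)%N = n by rewrite mul2n even_halfK.
  exists n./2; rewrite nE -Vn -Un; split=> //.
  (* Index 0 gives y = 0. *)
  case: (posnP n./2) => // n0; move: y0.
  by rewrite Un -nE n0.
- have [V0 U0] := genLucas_genFib_gt0 (2 * n) hk.
  have E := genLucas_genFib_norm k (2 * n).
  split=> //; split; last by rewrite E exprM sqrrN !expr1n mulr1.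
  (* From the previous index, 2 U is a sum of k * 2 U >= 0 and V > 0. *)
  case: n n1 V0 U0 E => // n _ _ _ _; rewrite mulnS add2n.
  have [_ ->] := genLucas_genFib_succ k (2 * n).+1.
  have [] := genLucas_genFib_gt0 (2 * n).+1 hk; nia.
Qed.
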